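(* Let $q$ be a power of $2$, let $0<i<m$ be integers with $i\mid m$, and let $a,b\in\mathbb{F}_q\setminus\{0\}$. Then the polycyclic code $C$ over $\mathbb{F}_q$ of length $2m$ associated with the trinomial $x^{2m}+a^2x^{2i}+b^2$ and generated by $g(x)=x^m+ax^i+b$ is isodual.
   Context: Vectors $(c_0,\dots,c_{n-1})\in\mathbb{F}_q^n$ are identified with polynomials $c_0+c_1x+\cdots+c_{n-1}x^{n-1}$. For a monic polynomial $f(x)\in\mathbb{F}_q[x]$ of degree $n$ and a monic divisor $g(x)$ of $f(x)$, the polycyclic code associated with $f(x)$ and generated by $g(x)$ is the ideal $\langle g(x)\rangle$ of $\mathbb{F}_q[x]/\langle f(x)\rangle$, i.e. the set of all multiples of $g(x)$ of degree less than $n$, viewed as a linear code of length $n$. Two linear codes $C_1,C_2$ of length $n$ over $\mathbb{F}_q$ are equivalent if there is a monomial $n\times n$ matrix $M$ over $\mathbb{F}_q$ (exactly one non-zero entry in each row and each column) with $C_2=\{cM: c\in C_1\}$. The dual $C^\perp$ is taken with respect to the Euclidean inner product; $C$ is isodual if $C$ is equivalent to $C^\perp$. *)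

(* Defs.v *)
From mathcomp Require Import all_boot all_order all_algebra.

Set Implicit Arguments.
Unset Strict Implicit.
Unset Printing Implicit Defensive.

Import GRing.Theory.
Local Open Scope ring_scope.

Section Codes.

Variable F : finFieldType.

(* A code is the set of its words. Linearity is not part of the type:          *)
(* polycyclic codes and duals are subspaces by construction.                   *)

Definition monomial_mx n (M : 'M[F]_n) : Prop :=
  (forall i, #|[set j | M i j != 0]| = 1%N) /\
  (forall j, #|[set i | M i j != 0]| = 1%N).

Definition code_equiv n (C1 C2 : {set 'rV[F]_n}) : Prop :=
  exists2 M : 'M[F]_n, monomial_mx M & C2 = [set c *m M | c in C1].

(* For row vectors, v *m c^T is the 1 x 1 matrix holding \sum_i v_i c_i.       *)
Definition dual_code n (C : {set 'rV[F]_n}) : {set 'rV[F]_n} :=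
  [set v | [forall c in C, v *m c^T == 0]].

Definition isodual n (C : {set 'rV[F]_n}) : Prop := code_equiv C (dual_code C).

Definition qpoly_ideal (f g : {poly F}) : {set {poly %/ f}} :=
  [set p * in_qpoly f g | p : {poly %/ f}].

(* Meant for f monic of degree n > 0: {poly %/ f} is then F[x]/<f>, a residue  *)
(* class being its representative of degree < n (for other f the library       *)
(* divides by 'X instead). rVpoly c is c_0 + c_1 'X + ... + c_(n-1) 'X^(n-1).  *)
Definition polycyclic_code n (f g : {poly F}) : {set 'rV[F]_n} :=
  [set c | [exists u in qpoly_ideal f g, rVpoly c == u :> {poly F}]].

End Codes.

(* Main.v *)
Require Import Defs.
From mathcomp Require Import all_boot all_order all_algebra.
From mathcomp Require Import all_fingroup all_field zify.
Import GRing.Theory.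
Local Open Scope ring_scope.

(* Write n = 2m, c = 2i, f = x^n + alpha x^c + beta, and let lambda(p) be the
   coefficient of x^(c-1) in p mod f. Since lambda(x^t), for 0 <= t <= 2n-2,
   is 1 at t = c-1, -beta at t = n+c-1, and 0 elsewhere, the bilinear form
   (u, v) |-> lambda(uv) has a monomial, hence invertible, matrix M. If
   f = g h, then uv = 0 mod f for u in <h> and v in <g>, so M maps <h> into
   the dual of <g>; conversely lambda(w g p) = 0 for all p forces f | w g by
   nondegeneracy, i.e. h | w. So <h> is equivalent to the dual of <g>. In
   characteristic 2 the given trinomial is g^2, so that h = g. *)

Lemma monomial_diag_perm {F : finFieldType} {n : nat} (d : 'rV[F]_n)
    (s : 'S_n) :
  (forall k, d 0 k != 0) -> monomial_mx (diag_mx d *m perm_mx s).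
Proof.
move=> d_neq0.
have ME i j : ((diag_mx d *m perm_mx s) i j != 0) = (s i == j).
  rewrite mul_diag_mx !mxE; case: (s i == j); last by rewrite mulr0 eqxx.
  by rewrite mulr1 d_neq0.
split=> [i | j].
  rewrite -(cards1 (s i)); congr #|pred_of_set _|.
  by apply/setP=> j; rewrite !inE ME eq_sym.
rewrite -(cards1 ((s^-1)%g j)); congr #|pred_of_set _|.
by apply/setP=> i; rewrite !inE ME -(inj_eq (@perm_inj _ s) i) permKV.
Qed.

Lemma unitmx_diag_perm {F : finFieldType} {n : nat} (d : 'rV[F]_n) (s : 'S_n) :
  (forall k, d 0 k != 0) -> diag_mx d *m perm_mx s \in unitmx.
Proof.
move=> d_neq0; rewrite unitmx_mul unitmx_perm andbT unitmxE det_diag unitfE.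
by apply/prodf_neq0=> k _.
Qed.

Lemma mul_diag_perm_tr {F : finFieldType} {n : nat} (d : 'rV[F]_n) (s : 'S_n)
    (u v : 'rV[F]_n) :
  (u *m (diag_mx d *m perm_mx s) *m v^T) 0 0 =
  \sum_k u 0 k * d 0 k * v 0 (s k).
Proof.
rewrite mulmxA -mulmxA -row_permE mul_mx_diag !mxE.
by apply: eq_bigr => k _; rewrite !mxE.
Qed.

Lemma mem_dual_code {F : finFieldType} {n : nat} (C : {set 'rV[F]_n})
    (v : 'rV[F]_n) :
  reflect (forall c, c \in C -> (v *m c^T) 0 0 = 0) (v \in dual_code C).
Proof.
rewrite inE; apply: (iffP forall_inP) => H c /H; first by move/eqP->; rewrite mxE.
by move=> vc0; apply/eqP/matrixP=> i j; rewrite !ord1 vc0 mxE.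
Qed.

(** As [g] divides [f], reduction mod [f] does not affect divisibility by [g], so membership in the
    ideal can be tested on the representative of degree below [n]. *)
Lemma mem_polycyclic_code {F : finFieldType} {n : nat} (f g : {poly F})
    (c : 'rV[F]_n) :
  (0 < n)%N -> f \is monic -> size f = n.+1 -> g %| f ->
  (c \in polycyclic_code n f g) = (g %| rVpoly c).
Proof.
move=> n_gt0 f_monic szf gf.
have fE : mk_monic f = f by rewrite /mk_monic szf ltnS n_gt0 f_monic.
have valE p : in_qpoly f p = p %% f :> {poly F}.
  by rewrite /= fE Pdiv.IdomainMonic.modpE.
rewrite inE; apply/exists_inP/idP => [[u /imsetP[p _ ->] /eqP->] | /dvdpP[p cE]].
  have -> : p = in_qpoly f p.
    by apply/val_inj; rewrite [RHS]in_qpoly_small // size_mk_monic.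
  by rewrite -in_qpolyM valE -(dvdp_mod _ gf) dvdp_mull.
exists (in_qpoly f (p * g)); last first.
  by rewrite valE -cE modp_small // szf ltnS size_poly.
by apply/imsetP; exists (in_qpoly f p); rewrite ?inE ?in_qpolyM.
Qed.

(* k and block_rev n c k add up to c - 1 or to n + c - 1. *)
Definition block_rev (n c : nat) (k : 'I_n) : 'I_n :=
  insubd k ((if (k < c)%N then c else n + c).-1 - k)%N.

(** For [c <= n] the difference stays below [n], so the default [k] of [insubd] is never taken. *)
Lemma val_block_rev (n c : nat) (k : 'I_n) : (c <= n)%N ->
  block_rev n c k = ((if (k < c)%N then c else n + c).-1 - k)%N :> nat.
Proof.
move=> le_cn; rewrite val_insubd; have := ltn_ord k.
by case: ifP => // /negP; case: ifP; lia.
Qed.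

(** Each of the blocks [0, c) and [c, n) is reversed within itself. *)
Lemma block_revK (n c : nat) : (c <= n)%N -> involutive (@block_rev n c).
Proof.
move=> le_cn k; apply/val_inj; rewrite /= !val_block_rev //.
by have := ltn_ord k; do 2!case: ifP; lia.
Qed.

(** Closed form of lambda, valid up to degree 2n - 2. *)
Definition fold_coef {F : finFieldType} (n c : nat) (beta : F) (p : {poly F}) :=
  p`_c.-1 - beta * p`_(n + c).-1.

Section TrinomialCodes.

Context {F : finFieldType} (n c : nat) (alpha beta : F).
Context (c_gt0 : (0 < c)%N) (lt_cn : (c < n)%N) (beta_neq0 : beta != 0).
Let f : {poly F} := 'X^n + alpha *: 'X^c + beta%:P.

Lemma size_trinomial : size f = n.+1.
Proof.
rewrite /f -addrA size_polyDl size_polyXn // ltnS (leq_trans (size_polyD _ _)) //.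
rewrite geq_max (leq_trans (size_scale_leq _ _)) ?size_polyXn //.
by rewrite (leq_trans (size_polyC_leq1 _)) //; lia.
Qed.

Lemma monic_trinomial : f \is monic.
Proof.
rewrite monicE lead_coefE size_trinomial /f !coefE eqxx.
by rewrite [_ == c]gtn_eqF // [_ == 0]gtn_eqF ?mulr0 ?addr0 //; lia.
Qed.

(** If p = r f, the coefficient at c - 1 is beta r_(c-1), and the one at n + c - 1 is r_(c-1) +
    alpha r_(n-1) + beta r_(n+c-1). The size bound forces deg r <= n - 2, which removes the last two
    terms. *)
Lemma fold_coef_eq0 (p : {poly F}) :
  f %| p -> (size p < n + n)%N -> fold_coef n c beta p = 0.
Proof.
move=> /dvdpP[r ->]; have [-> | r_neq0] := eqVneq r 0.
  by rewrite mul0r /fold_coef !coef0 mulr0 subr0.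
rewrite size_Mmonic ?monic_trinomial // size_trinomial addnS /= ltn_add2r => szr.
have r_eq0 k : (n.-1 <= k)%N -> r`_k = 0.
  move=> le_nk; rewrite nth_default // (leq_trans _ le_nk) // -ltnS.
  by rewrite prednK //; lia.
rewrite /fold_coef /f !mulrDr -!scalerAr !coefD !coefZ !coefMXn !coefMC.
have -> : (c.-1 < n)%N by lia.
have -> : (c.-1 < c)%N by lia.
have -> : ((n + c).-1 < n)%N = false by lia.
have -> : ((n + c).-1 < c)%N = false by lia.
have -> : ((n + c).-1 - n = c.-1)%N by lia.
rewrite (r_eq0 ((n + c).-1 - c)%N) ?(r_eq0 (n + c).-1); [|lia..].
by rewrite mulr0 mul0r !addr0 add0r mulrC subrr.
Qed.

Lemma fold_coef_mod (p : {poly F}) :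
  (size p < n + n)%N -> fold_coef n c beta p = (p %% f)`_c.-1.
Proof.
move=> szp.
have szm : (size (p %% f)%R <= n)%N.
  by rewrite -ltnS -size_trinomial ltn_modp monic_neq0 ?monic_trinomial.
(* The remainder has no coefficient at n + c - 1 >= n, so only its coefficient at c - 1 survives. *)
have : fold_coef n c beta (p - p %% f) = 0.
  apply: fold_coef_eq0; first by rewrite {1}(divp_eq p f) addrK dvdp_mull.
  rewrite (leq_ltn_trans (size_polyD _ _)) // size_polyN gtn_max szp /=.
  by rewrite (leq_ltn_trans szm) //; lia.
rewrite /fold_coef !coefB [(p %% f)`_(n + c).-1]nth_default; last first.
  by rewrite (leq_trans szm) //; lia.
by rewrite subr0 addrAC => /eqP; rewrite subr_eq0 => /eqP.
Qed.

(** The value of lambda at the product of x^k and its partner x^(block_rev k), which is x^(c-1) or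
    x^(n+c-1). *)
Definition fold_weight : 'rV[F]_n :=
  \row_(k < n) (if (k < c)%N then 1 else - beta).

(** Gram matrix of (u, v) |-> lambda(uv) in the basis of powers of x. *)
Definition fold_mx : 'M[F]_n :=
  diag_mx fold_weight *m perm_mx (perm (can_inj (block_revK n c (ltnW lt_cn)))).

Lemma fold_mxP (u v : 'rV[F]_n) :
  (u *m fold_mx *m v^T) 0 0 = fold_coef n c beta (rVpoly u * rVpoly v).
Proof.
rewrite mul_diag_perm_tr.
pose G k := (rVpoly u)`_k * (if (k < c)%N then 1 else - beta) *
  (rVpoly v)`_((if (k < c)%N then c else n + c).-1 - k).
transitivity (\sum_(k < n) G k).
  apply: eq_bigr => k _; rewrite /G coef_rVpoly_ord mxE permE.
  by rewrite -val_block_rev ?coef_rVpoly_ord // ltnW.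
(* The rows k < c give the coefficient at c - 1, the others -beta times the one at n + c - 1. *)
rewrite -(big_mkord xpredT G) (big_cat_nat _ (ltnW lt_cn)) //=.
rewrite /fold_coef !coefM !prednK ?addn_gt0 ?c_gt0 ?orbT //.
congr (_ + _).
  by rewrite big_mkord; apply: eq_bigr => k _; rewrite /G ltn_ord mulr1.
(* In the coefficient at n + c - 1, a term with k < c involves a coefficient of [v] of index >= n,
   and one with k >= n such a coefficient of [u]; only c <= k < n remains. *)
pose H k := (rVpoly u)`_k * (rVpoly v)`_((n + c).-1 - k).
rewrite -(big_mkord xpredT H).
rewrite (@big_cat_nat _ _ _ c 0 (n + c)) ?leq_addl //=.
rewrite (@big_cat_nat _ _ _ n c (n + c)) ?leq_addr ?(ltnW lt_cn) //=.
rewrite (big1_seq (index_iota 0 c)); last first.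
  move=> k /andP[_]; rewrite mem_index_iota => k_lt_c.
  rewrite /H [X in _ * X]nth_default ?mulr0 // (leq_trans (size_poly _ _)) //.
  lia.
rewrite (big1_seq (index_iota n _)); last first.
  move=> k /andP[_]; rewrite mem_index_iota => /andP[n_le_k _].
  by rewrite /H [X in X * _]nth_default ?mul0r // (leq_trans (size_poly _ _)).
rewrite add0r addr0 -mulNr mulr_sumr; apply: eq_big_nat => k /andP[c_le_k _].
by rewrite /G /H ltnNge c_le_k mulrCA mulrA.
Qed.

Lemma code_equiv_dual_cofactor (g h : {poly F}) : f = g * h ->
  code_equiv (polycyclic_code n f h) (dual_code (polycyclic_code n f g)).
Proof.
move=> fE.
have n_gt0 : (0 < n)%N by lia.
have f_neq0 := monic_neq0 monic_trinomial.
have g_neq0 : g != 0 by apply: contraNneq f_neq0 => g0; rewrite fE g0 mul0r.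
have gf : g %| f by rewrite fE dvdp_mulr.
have hf : h %| f by rewrite fE dvdp_mull.
have memP e x : e %| f -> (x \in polycyclic_code n f e) = (e %| rVpoly x).
  exact: mem_polycyclic_code n_gt0 monic_trinomial size_trinomial.
have weight_neq0 k : fold_weight 0 k != 0.
  by rewrite mxE; case: ifP; rewrite ?oner_eq0 ?oppr_eq0.
have Munit : fold_mx \in unitmx by apply: unitmx_diag_perm.
have formE (x y : 'rV_n) :
    (x *m fold_mx *m y^T) 0 0 = ((rVpoly x * rVpoly y) %% f)`_c.-1.
  rewrite fold_mxP fold_coef_mod // (leq_ltn_trans (size_polyMleq _ _)) //.
  have : (size (rVpoly x) <= n)%N by exact: size_poly.
  have : (size (rVpoly y) <= n)%N by exact: size_poly.
  lia.
exists fold_mx; first exact: monomial_diag_perm.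
apply/setP=> v; apply/mem_dual_code/imsetP => [v_dual | [x Cx ->] y].
  exists (v *m invmx fold_mx); last by rewrite mulmxKV.
  set x := v *m _; rewrite memP //.
  have szm (p : {poly F}) : (size (p %% f)%R <= n)%N.
    by rewrite -ltnS -size_trinomial ltn_modp.
  (* Once the residue [z] of x g vanishes, g h divides x g, and cancelling g gives h | x. *)
  pose z : 'rV_n := poly_rV ((rVpoly x * g) %% f).
  suff z0 : z = 0.
    have := poly_rV_K (szm (rVpoly x * g)); rewrite -/z z0 linear0 => /esym/eqP.
    by rewrite -/(dvdp _ _) fE mulrC dvdp_mul2r.
  (* By invertibility of [fold_mx], it suffices to pair [z] with each unit vector. *)
  apply: (can_inj (mulmxK Munit)); rewrite mul0mx.
  apply/rowP=> j; rewrite [RHS]mxE.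
  have -> : (z *m fold_mx) 0 j = (z *m fold_mx *m (delta_mx 0 j : 'rV_n)^T) 0 0.
    by rewrite trmx_delta -colE [RHS]mxE.
  (* Moving g from x to the unit vector gives a word [y] of the code of g with the same pairing, and
     [v] is orthogonal to it. *)
  pose y : 'rV_n := poly_rV ((g * rVpoly (delta_mx 0 j : 'rV_n)) %% f).
  have Cy : y \in polycyclic_code n f g.
    by rewrite memP // poly_rV_K // -dvdp_mod // dvdp_mulr.
  rewrite -(v_dual _ Cy) -[v](mulmxKV Munit) -/x !formE !poly_rV_K //.
  rewrite modp_mul [(_ %% f) * _]mulrC modp_mul.
  by rewrite [rVpoly (delta_mx _ _) * (_ * _)]mulrC mulrA.
rewrite memP // => gy; rewrite formE; move: Cx; rewrite memP // => hx.
have /modp_eq0P -> : f %| rVpoly x * rVpoly y by rewrite fE mulrC dvdp_mul.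
by rewrite coef0.
Qed.

End TrinomialCodes.

Theorem theorem4p2 (F : finFieldType) (k : nat) (cardF : #|F| = (2 ^ k)%N)
    (i m : nat) (i_gt0 : (0 < i)%N) (lt_im : (i < m)%N) (dvd_im : (i %| m)%N)
    (a b : F) (a_neq0 : a != 0) (b_neq0 : b != 0) :
  isodual
    (polycyclic_code (2 * m)
       ('X^(2 * m) + (a ^+ 2) *: 'X^(2 * i) + (b ^+ 2)%:P : {poly F})
       ('X^m + a *: 'X^i + b%:P)).
Proof.
have F2 : 2 \in [pchar F] by apply: card_finPcharP cardF _.
have P2 : 2 \in [pchar {poly F}] by rewrite pchar_poly.
apply: code_equiv_dual_cofactor; [lia | lia | by rewrite expf_neq0 |].
(* The cross terms of the square carry a factor 2 and vanish. *)
rewrite -expr2 !sqrrD !(mulrn_pchar P2) !addr0 exprZn -!exprM -polyC_exp.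
by rewrite ![(2 * _)%N]mulnC.
Qed.
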